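(* Let $M$ and $N$ be semisimple MV-algebras and $p\colon M\to N$ a probability map. There exists a unique unital positive linear operator $L_p\colon C_{\mathbb{R}}(\operatorname{Max}M)\to C_{\mathbb{R}}(\operatorname{Max}N)$ such that $p(a)^{*}=L_p(a^{*})$ for every $a\in M$.
   Context: For an MV-algebra $(M,\oplus,\neg,0)$: $1\coloneqq\neg 0$, $a\vee b\coloneqq\neg(\neg a\oplus b)\oplus b$, $a\wedge b\coloneqq\neg(\neg a\vee\neg b)$. A probability map is a function $p\colon M\to N$ between MV-algebras such that for all $a,b\in M$: (P1) $p(a\oplus b)=p(a)\oplus p(b\wedge\neg a)$; (P2) $p(\neg a)=\neg p(a)$; (P3) $p(1)=1$. $\operatorname{Max}M$ is the compact Hausdorff space of maximal ideals of $M$ (with the hull-kernel topology). For each $\mathfrak{m}\in\operatorname{Max}M$ there is a unique MV-isomorphism $h_{\mathfrak{m}}$ of $M/\mathfrak{m}$ onto an MV-subalgebra of the standard MV-algebra $[0,1]$; for $a\in M$, $a^{*}\colon\operatorname{Max}M\to[0,1]$ is defined by $a^*(\mathfrak{m})=h_{\mathfrak{m}}(a/\mathfrak{m})$, which is continuous. $M$ is semisimple if the intersection of all maximal ideals is $\{0\}$ (equivalently $a\mapsto a^*$ is injective). $C_{\mathbb{R}}(X)$ is the Banach lattice of continuous real functions on $X$ with the sup norm; a unital positive linear operator $L\colon C_{\mathbb{R}}(X)\to C_{\mathbb{R}}(Y)$ is a linear map with $L(a)\geq 0$ whenever $a\geq 0$ and $L(1)=1$. *)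

(* Defs.v *)
From Stdlib Require Import Reals Rtopology ClassicalEpsilon.
Open Scope R_scope.

Record MVAlgebra := {
  mv_car :> Type;
  mv_oplus : mv_car -> mv_car -> mv_car;
  mv_neg : mv_car -> mv_car;
  mv_zero : mv_car;
  mv_assoc : forall x y z, mv_oplus x (mv_oplus y z) = mv_oplus (mv_oplus x y) z;
  mv_comm : forall x y, mv_oplus x y = mv_oplus y x;
  mv_zeroR : forall x, mv_oplus x mv_zero = x;
  mv_negK : forall x, mv_neg (mv_neg x) = x;
  mv_oneR : forall x, mv_oplus x (mv_neg mv_zero) = mv_neg mv_zero;
  mv_luk : forall x y, mv_oplus (mv_neg (mv_oplus (mv_neg x) y)) y
                     = mv_oplus (mv_neg (mv_oplus (mv_neg y) x)) x
}.

Arguments mv_oplus {m}.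
Arguments mv_neg {m}.
Arguments mv_zero {m}.

Definition mv_one {M : MVAlgebra} : M := mv_neg mv_zero.
Definition mv_join {M : MVAlgebra} (a b : M) : M :=
  mv_oplus (mv_neg (mv_oplus (mv_neg a) b)) b.
Definition mv_meet {M : MVAlgebra} (a b : M) : M :=
  mv_neg (mv_join (mv_neg a) (mv_neg b)).
Definition mv_le {M : MVAlgebra} (a b : M) : Prop :=
  mv_oplus (mv_neg a) b = mv_one.

Definition is_ideal {M : MVAlgebra} (I : M -> Prop) : Prop :=
  I mv_zero /\
  (forall a b : M, mv_le a b -> I b -> I a) /\
  (forall a b : M, I a -> I b -> I (mv_oplus a b)).

Definition is_proper_ideal {M : MVAlgebra} (I : M -> Prop) : Prop :=
  is_ideal I /\ ~ I mv_one.

Definition is_maximal_ideal {M : MVAlgebra} (I : M -> Prop) : Prop :=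
  is_proper_ideal I /\
  forall J : M -> Prop, is_proper_ideal J -> (forall a, I a -> J a) ->
    forall a, J a -> I a.

Definition MaxSpec (M : MVAlgebra) : Type := { m : M -> Prop | is_maximal_ideal m }.

Definition semisimple (M : MVAlgebra) : Prop :=
  forall a : M, (forall m : MaxSpec M, proj1_sig m a) -> a = mv_zero.

(* closed sets are the hulls {m | S ⊆ m}; open sets their complements *)
Definition hk_open {M : MVAlgebra} (O : MaxSpec M -> Prop) : Prop :=
  exists S : M -> Prop,
    forall m : MaxSpec M, O m <-> exists a, S a /\ ~ proj1_sig m a.

Definition hk_continuous {M : MVAlgebra} (f : MaxSpec M -> R) : Prop :=
  forall U : R -> Prop, open_set U -> hk_open (fun m => U (f m)).

Definition mv_hom_unit {M : MVAlgebra} (h : M -> R) : Prop :=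
  (forall a, 0 <= h a <= 1) /\
  h mv_zero = 0 /\
  (forall a b, h (mv_oplus a b) = Rmin 1 (h a + h b)) /\
  (forall a, h (mv_neg a) = 1 - h a).

(* h_m composed with the quotient map M -> M/m: the (unique) MV-homomorphism
   M -> [0,1] whose kernel is exactly m. *)
Definition hstar {M : MVAlgebra} (m : MaxSpec M) : M -> R :=
  epsilon (inhabits (fun _ : M => 0))
    (fun h => mv_hom_unit h /\ forall a, h a = 0 <-> proj1_sig m a).

Definition star {M : MVAlgebra} (a : M) : MaxSpec M -> R :=
  fun m => hstar m a.

Definition probability_map {M N : MVAlgebra} (p : M -> N) : Prop :=
  (forall a b : M, p (mv_oplus a b) = mv_oplus (p a) (p (mv_meet b (mv_neg a)))) /\
  (forall a : M, p (mv_neg a) = mv_neg (p a)) /\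
  p mv_one = mv_one.

(* An operator C_R(Max M) -> C_R(Max N) is represented by a map on all
   functions; only its behaviour on continuous functions matters. *)
Definition unital_positive_linear {M N : MVAlgebra}
    (L : (MaxSpec M -> R) -> (MaxSpec N -> R)) : Prop :=
  (forall f, hk_continuous f -> hk_continuous (L f)) /\
  (forall f g, hk_continuous f -> hk_continuous g ->
     forall y, L (fun x => f x + g x) y = L f y + L g y) /\
  (forall (c : R) f, hk_continuous f ->
     forall y, L (fun x => c * f x) y = c * L f y) /\
  (forall f, hk_continuous f -> (forall x, 0 <= f x) -> forall y, 0 <= L f y) /\
  (forall y, L (fun _ => 1) y = 1).

(* Main.v *)
(* Each point n of Max N gives a state a |-> h_n(p a) on M, that is, an additive
   function into [0,1].  By semisimplicity, sums of transforms a* that are ordered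
   pointwise have ordered good sequences, termwise in M; since a state adds up to
   the same value along the good sequence of a finite sum, it is positive on the
   integral, hence on the real, span of the a*.  This span is uniformly dense:
   compactness of Max M yields Urysohn functions that are themselves of the form u*,
   and every continuous function is within eps of an affine combination of those.
   So the state extends uniquely to a positive functional, and the values at
   all n form a continuous function as a uniform limit of combinations of p(a)*.
   The homomorphism M/m -> [0,1] itself comes from Hoelder's theorem: M/m is a simple
   chain, and an element is sent to the real number whose binary digits record
   the carries in its successive doublings. *)
Require Import Defs.
From Stdlib Require Import Reals Rtopology ClassicalEpsilon.
From Stdlib Require Import Lra Lia List ProofIrrelevance.
From Stdlib Require Import FunctionalExtensionality PropExtensionality.
From mathcomp Require classical_sets.
Open Scope R_scope.
Set Bullet Behavior "Strict Subproofs".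

Local Notation "x ⊕ y" := (mv_oplus x y) (at level 50, left associativity).
Local Notation "¬ x" := (mv_neg x) (at level 35, right associativity).

(** The Lukasiewicz product. Combined with a negation, [a ⊙ ¬ b] is the truncated difference, the
    form in which order and congruences are handled below. *)
Definition mv_times {M : MVAlgebra} (a b : M) : M := ¬ (¬ a ⊕ ¬ b).
Local Notation "x ⊙ y" := (mv_times x y) (at level 40, left associativity).

(** * Arithmetic of MV-algebras *)

Section Arithmetic.
Context {M : MVAlgebra}.
Implicit Types a b c x y z : M.

Lemma neg_one : ¬ mv_one = (mv_zero : M).
Proof. apply mv_negK. Qed.

Lemma oplus_0r a : a ⊕ mv_zero = a.
Proof. apply mv_zeroR. Qed.

Lemma oplus_0l a : mv_zero ⊕ a = a.
Proof. rewrite mv_comm; apply mv_zeroR. Qed.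

Lemma oplus_1r a : a ⊕ mv_one = mv_one.
Proof. apply mv_oneR. Qed.

Lemma oplus_1l a : mv_one ⊕ a = mv_one.
Proof. rewrite mv_comm; apply mv_oneR. Qed.

Lemma oplus_negl a : ¬ a ⊕ a = mv_one.
Proof.
  pose proof (mv_luk M a mv_one) as H.
  rewrite !oplus_1r, neg_one, oplus_0l in H; congruence.
Qed.

Lemma oplus_negr a : a ⊕ ¬ a = mv_one.
Proof. rewrite mv_comm; apply oplus_negl. Qed.

Lemma oplus_ac a b c : a ⊕ (b ⊕ c) = b ⊕ (a ⊕ c).
Proof. rewrite !mv_assoc, (mv_comm _ a b); reflexivity. Qed.

Lemma neg_times a b : ¬ (a ⊙ b) = ¬ a ⊕ ¬ b.
Proof. apply mv_negK. Qed.

Lemma neg_oplus a b : ¬ (a ⊕ b) = ¬ a ⊙ ¬ b.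
Proof. unfold mv_times; rewrite !mv_negK; reflexivity. Qed.

Lemma times_comm a b : a ⊙ b = b ⊙ a.
Proof. unfold mv_times; rewrite mv_comm; reflexivity. Qed.

Lemma times_assoc a b c : a ⊙ (b ⊙ c) = a ⊙ b ⊙ c.
Proof. unfold mv_times; rewrite !mv_negK, mv_assoc; reflexivity. Qed.

Lemma times_negr a : a ⊙ ¬ a = mv_zero.
Proof. unfold mv_times; rewrite oplus_negr; apply neg_one. Qed.

Lemma times_1r a : a ⊙ mv_one = a.
Proof. unfold mv_times; rewrite neg_one, oplus_0r; apply mv_negK. Qed.

Lemma times_0l a : mv_zero ⊙ a = mv_zero.
Proof. unfold mv_times; fold (mv_one : M); rewrite oplus_1l; apply neg_one. Qed.

Lemma times_0r a : a ⊙ mv_zero = mv_zero.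
Proof. rewrite times_comm; apply times_0l. Qed.

Lemma join_comm a b : a ⊙ ¬ b ⊕ b = b ⊙ ¬ a ⊕ a.
Proof. unfold mv_times; rewrite !mv_negK; apply mv_luk. Qed.

Lemma meet_comm a b : a ⊙ (¬ a ⊕ b) = b ⊙ (¬ b ⊕ a).
Proof.
  pose proof (mv_luk M (¬ b) (¬ a)) as H. rewrite !mv_negK in H.
  unfold mv_times. f_equal.
  rewrite (mv_comm _ (¬ a)), (mv_comm _ (¬ b)), (mv_comm _ (¬ a) b), (mv_comm _ (¬ b) a).
  exact H.
Qed.

Lemma le_times0 a b : mv_le a b <-> a ⊙ ¬ b = mv_zero.
Proof.
  unfold mv_le; split; intro H.
  - unfold mv_times; rewrite mv_negK, H; apply neg_one.
  - rewrite <- (mv_negK _ (¬ a ⊕ b)), neg_oplus, mv_negK, H; reflexivity.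
Qed.

(** Turns an inequality into an equation; monotonicity and transitivity then reduce to
    [le_oplus]. *)
Lemma le_decomp a b : mv_le a b -> b = a ⊕ b ⊙ ¬ a.
Proof.
  rewrite le_times0; intro H. pose proof (join_comm a b) as J.
  rewrite H, oplus_0l, mv_comm in J; exact J.
Qed.

Lemma le_oplus a b : mv_le a (a ⊕ b).
Proof. unfold mv_le; rewrite mv_assoc, oplus_negl; apply oplus_1l. Qed.

Lemma le_refl a : mv_le a a.
Proof. apply oplus_negl. Qed.

Lemma le_trans b a c : mv_le a b -> mv_le b c -> mv_le a c.
Proof.
  intros Hab Hbc. rewrite (le_decomp b c Hbc), (le_decomp a b Hab), <- mv_assoc.
  apply le_oplus.
Qed.

Lemma le_antisym a b : mv_le a b -> mv_le b a -> a = b.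
Proof.
  intros Hab Hba. rewrite (le_decomp a b Hab). apply le_times0 in Hba.
  rewrite Hba, oplus_0r; reflexivity.
Qed.

Lemma le_1 a : mv_le a mv_one.
Proof. apply oplus_1r. Qed.

Lemma one_le a : mv_le mv_one a -> a = mv_one.
Proof. intro H; apply le_antisym; [apply le_1|exact H]. Qed.

Lemma oplus_mono a b c : mv_le a b -> mv_le (a ⊕ c) (b ⊕ c).
Proof.
  intro H; rewrite (le_decomp a b H), <- mv_assoc, (mv_comm _ (b ⊙ ¬ a)), mv_assoc.
  apply le_oplus.
Qed.

Lemma oplus_mono2 a b c d : mv_le a b -> mv_le c d -> mv_le (a ⊕ c) (b ⊕ d).
Proof.
  intros H H'. apply (le_trans (b ⊕ c)); [apply oplus_mono, H|].
  rewrite !(mv_comm _ b); apply oplus_mono, H'.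
Qed.

Lemma neg_mono a b : mv_le a b -> mv_le (¬ b) (¬ a).
Proof. unfold mv_le; rewrite mv_negK, mv_comm; trivial. Qed.

Lemma times_le_l a b : mv_le (a ⊙ b) a.
Proof.
  rewrite <- (mv_negK _ a) at 2. unfold mv_times. apply neg_mono, le_oplus.
Qed.

Lemma residuation a b c : mv_le (a ⊙ b) c <-> mv_le a (¬ b ⊕ c).
Proof. unfold mv_le; rewrite neg_times, mv_assoc; tauto. Qed.

Lemma le_join_l a b : mv_le a (b ⊕ a ⊙ ¬ b).
Proof. rewrite mv_comm, join_comm, mv_comm; apply le_oplus. Qed.

Lemma times_diff_triangle a b c : mv_le (a ⊙ ¬ c) (a ⊙ ¬ b ⊕ b ⊙ ¬ c).
Proof.
  apply residuation. rewrite mv_negK, oplus_ac, mv_comm.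
  apply (le_trans (b ⊕ a ⊙ ¬ b)); [apply le_join_l|].
  apply oplus_mono, le_join_l.
Qed.

Lemma oplus_diff a b c : mv_le ((a ⊕ c) ⊙ ¬ (b ⊕ c)) (a ⊙ ¬ b).
Proof.
  apply residuation.
  rewrite mv_negK, <- mv_assoc, (mv_comm _ c), mv_assoc.
  apply oplus_mono, le_join_l.
Qed.

(** The two truncated differences have meet 0, so removing one from the other changes nothing; this
    is what makes simple algebras chains. *)
Lemma prelinear a b : a ⊙ ¬ b ⊙ ¬ (b ⊙ ¬ a) = a ⊙ ¬ b.
Proof.
  set (u := a ⊙ ¬ b). set (v := b ⊙ ¬ a). set (w := b ⊕ v).
  (* [u ⊙ (¬ u ⊕ v)] is the meet of [u] and [v]. Three exchanges by [meet_comm] bring out a factor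
     [b ⊙ ¬ b]. *)
  assert (Hmeet : u ⊙ (¬ u ⊕ v) = mv_zero).
  { replace (u ⊙ (¬ u ⊕ v)) with (¬ b ⊙ (a ⊙ (¬ a ⊕ w))).
    2:{ unfold u, w; rewrite neg_times, mv_negK, times_assoc, (times_comm a), mv_assoc.
        reflexivity. }
    rewrite (meet_comm a w). unfold w at 1.
    pose proof (meet_comm (¬ b) v) as E; rewrite mv_negK in E.
    rewrite times_assoc, E.
    pose proof (meet_comm (¬ a) (¬ w)) as F; rewrite !mv_negK in F.
    replace (v ⊙ (¬ v ⊕ ¬ b) ⊙ (¬ w ⊕ a))
      with ((¬ v ⊕ ¬ b) ⊙ (b ⊙ (¬ a ⊙ (a ⊕ ¬ w)))).
    2:{ unfold v at 2; rewrite (times_comm _ (¬ v ⊕ ¬ b)), !times_assoc, (mv_comm _ a).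
        reflexivity. }
    rewrite F. unfold w at 1.
    rewrite neg_oplus, !times_assoc, <- (times_assoc _ b), times_negr, times_0r, !times_0l.
    reflexivity. }
  assert (Hle : mv_le (u ⊙ ¬ v) u) by apply times_le_l.
  apply le_decomp in Hle.
  rewrite neg_times, mv_negK, mv_comm, (mv_comm _ _ v), (mv_comm _ v), Hmeet, oplus_0l in Hle.
  auto.
Qed.

(** In the unit interval both sides are the excess of a + b + c over 1. This law, its dual and the
    mixed law after it settle the cases of [frac_assoc]. *)
Lemma times_assoc_disjoint a b c :
  a ⊙ b = mv_zero -> b ⊙ c = mv_zero -> (a ⊕ b) ⊙ c = a ⊙ (b ⊕ c).
Proof.
  intros Hab Hbc.
  assert (Ha : mv_le b (¬ a)) by (apply le_times0; rewrite mv_negK, times_comm; exact Hab).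
  assert (Hc : mv_le b (¬ c)) by (apply le_times0; rewrite mv_negK; exact Hbc).
  unfold mv_times at 1 2. f_equal. rewrite !neg_oplus.
  rewrite (le_decomp _ _ Hc) at 1. rewrite (le_decomp _ _ Ha) at 2.
  rewrite oplus_ac, (times_comm (¬ c)), mv_assoc; reflexivity.
Qed.

Lemma oplus_assoc_codisjoint a b c :
  a ⊕ b = mv_one -> b ⊕ c = mv_one -> a ⊙ b ⊕ c = a ⊕ b ⊙ c.
Proof.
  intros Hab Hbc.
  pose proof (times_assoc_disjoint (¬ a) (¬ b) (¬ c)) as H.
  rewrite <- !neg_oplus, <- !neg_times, <- !neg_oplus, Hab, Hbc, neg_one in H.
  rewrite <- (mv_negK _ (a ⊙ b ⊕ c)), H, mv_negK; auto.
Qed.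

Lemma oplus_times_exchange a b c :
  a ⊙ b = mv_zero -> b ⊕ c = mv_one -> (a ⊕ b) ⊙ c = a ⊕ b ⊙ c.
Proof.
  intros Hab Hbc.
  assert (Hc : mv_le (¬ c) b) by (unfold mv_le; rewrite mv_negK, mv_comm; exact Hbc).
  assert (Ha : mv_le a (¬ b)) by (apply le_times0; rewrite mv_negK; exact Hab).
  assert (Hz : mv_le (a ⊕ b ⊙ c) c).
  { apply (le_trans (¬ b ⊕ b ⊙ c)); [apply oplus_mono, Ha|].
    pose proof (join_comm c (¬ b)) as J.
    rewrite mv_negK, <- neg_oplus, Hbc, neg_one, oplus_0l in J.
    rewrite mv_comm, (times_comm b), J; apply le_refl. }
  (* With z = [a ⊕ b ⊙ c], writing [b] as [¬ c ⊕ b ⊙ c] turns the left side into the meet of [c] and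
     z, which is z by [Hz]. *)
  rewrite (le_decomp _ _ Hc) at 1. rewrite mv_negK, oplus_ac, times_comm, meet_comm, Hz.
  apply times_1r.
Qed.

End Arithmetic.

Definition mv_nmul {M : MVAlgebra} (n : nat) (a : M) : M := Nat.iter n (mv_oplus a) mv_zero.

Definition mv_morphism {M N : MVAlgebra} (f : M -> N) : Prop :=
  f mv_zero = mv_zero /\ (forall a b, f (a ⊕ b) = f a ⊕ f b) /\ (forall a, f (¬ a) = ¬ f a).

(** * Quotients *)

Section Quotient.
Context {M : MVAlgebra} (I : M -> Prop) (HI : is_ideal I).

Definition ideal_equiv (a b : M) : Prop := I (a ⊙ ¬ b) /\ I (b ⊙ ¬ a).

Lemma ideal_equiv_refl a : ideal_equiv a a.
Proof. destruct HI as [H0 _]; split; rewrite times_negr; exact H0. Qed.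

Lemma ideal_equiv_sym a b : ideal_equiv a b -> ideal_equiv b a.
Proof. intros [H H']; split; assumption. Qed.

Lemma ideal_equiv_trans b a c : ideal_equiv a b -> ideal_equiv b c -> ideal_equiv a c.
Proof.
  destruct HI as [_ [Hle Hplus]]. intros [H1 H2] [H3 H4]; split.
  - apply (Hle _ _ (times_diff_triangle a b c)), Hplus; assumption.
  - apply (Hle _ _ (times_diff_triangle c b a)), Hplus; assumption.
Qed.

Lemma ideal_equiv_oplus a a' b b' :
  ideal_equiv a a' -> ideal_equiv b b' -> ideal_equiv (a ⊕ b) (a' ⊕ b').
Proof.
  destruct HI as [_ [Hle _]]. intros [H1 H2] [H3 H4].
  apply (ideal_equiv_trans (a' ⊕ b)).
  - split; eapply Hle; try apply oplus_diff; assumption.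
  - rewrite !(mv_comm _ a'). split; eapply Hle; try apply oplus_diff; assumption.
Qed.

Lemma ideal_equiv_neg a b : ideal_equiv a b -> ideal_equiv (¬ a) (¬ b).
Proof.
  intros [H H']; split; rewrite mv_negK, times_comm; assumption.
Qed.

(** Equivalent elements have extensionally equal classes, so [epsilon] picks the same element for
    both; the quotient is then a subset type with Leibniz equality. *)
Definition ideal_rep (a : M) : M := epsilon (inhabits mv_zero) (ideal_equiv a).

Lemma ideal_rep_spec a : ideal_equiv a (ideal_rep a).
Proof.
  apply (epsilon_spec (inhabits mv_zero) (ideal_equiv a)).
  exists a; apply ideal_equiv_refl.
Qed.

Lemma ideal_rep_eq a b : ideal_equiv a b <-> ideal_rep a = ideal_rep b.
Proof.
  split; intro H.
  - unfold ideal_rep; f_equal. apply functional_extensionality; intro c.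
    apply propositional_extensionality; split; apply ideal_equiv_trans;
      [apply ideal_equiv_sym|]; exact H.
  - apply (ideal_equiv_trans (ideal_rep a)); [apply ideal_rep_spec|].
    rewrite H; apply ideal_equiv_sym, ideal_rep_spec.
Qed.

Definition quot_car : Type := {a : M | ideal_rep a = a}.

Definition quot_class (a : M) : quot_car :=
  exist _ (ideal_rep a) (eq_sym (proj1 (ideal_rep_eq _ _) (ideal_rep_spec a))).

Lemma quot_class_eq a b : quot_class a = quot_class b <-> ideal_equiv a b.
Proof.
  rewrite ideal_rep_eq; split; intro H.
  - exact (f_equal (@proj1_sig _ _) H).
  - apply subset_eq_compat, H.
Qed.

Lemma quot_class_surj x : exists a, x = quot_class a.
Proof.
  destruct x as [a Ha]; exists a. apply subset_eq_compat; auto.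
Qed.

Definition quot_oplus (x y : quot_car) := quot_class (proj1_sig x ⊕ proj1_sig y).
Definition quot_neg (x : quot_car) := quot_class (¬ proj1_sig x).

Lemma quot_oplus_class a b : quot_oplus (quot_class a) (quot_class b) = quot_class (a ⊕ b).
Proof.
  apply quot_class_eq, ideal_equiv_oplus; apply ideal_equiv_sym, ideal_rep_spec.
Qed.

Lemma quot_neg_class a : quot_neg (quot_class a) = quot_class (¬ a).
Proof. apply quot_class_eq, ideal_equiv_neg, ideal_equiv_sym, ideal_rep_spec. Qed.

Local Ltac lift_axiom ax :=
  intros;
  repeat match goal with x : quot_car |- _ => destruct (quot_class_surj x); subst x end;
  rewrite ?quot_oplus_class, ?quot_neg_class, ?quot_oplus_class, ?quot_neg_class,
    ?quot_oplus_class, ?quot_neg_class, ?quot_oplus_class;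
  f_equal; apply ax.

Definition quotient : MVAlgebra.
Proof.
  refine {| mv_car := quot_car; mv_oplus := quot_oplus; mv_neg := quot_neg;
            mv_zero := quot_class mv_zero |}.
  - lift_axiom (mv_assoc M).
  - lift_axiom (mv_comm M).
  - lift_axiom (mv_zeroR M).
  - lift_axiom (mv_negK M).
  - lift_axiom (mv_oneR M).
  - lift_axiom (mv_luk M).
Defined.

End Quotient.

Lemma ideal_quotient (M : MVAlgebra) (I : M -> Prop) : is_ideal I ->
  exists (Q : MVAlgebra) (f : M -> Q),
    mv_morphism f /\ (forall x, exists a, x = f a) /\ (forall a, f a = mv_zero <-> I a).
Proof.
  intro HI. exists (quotient I HI), (quot_class I HI). repeat split.
  - intros; symmetry; apply (quot_oplus_class I HI).
  - intros; symmetry; apply (quot_neg_class I HI).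
  - apply (quot_class_surj I HI).
  - intro H. apply quot_class_eq in H. destruct H as [H _].
    fold (mv_one : M) in H. rewrite times_1r in H; exact H.
  - intro H. apply quot_class_eq. split.
    + fold (mv_one : M); rewrite times_1r; exact H.
    + rewrite times_0l; apply HI.
Qed.

(** * Simple MV-algebras embed into the unit interval *)

Section Simple.
Context {A : MVAlgebra}.
Hypothesis nontrivial : (mv_zero : A) <> mv_one.
Hypothesis simple : forall a : A, a <> mv_zero -> exists n, mv_nmul n a = mv_one.
Implicit Types a b c : A.

(** If [a ⊙ ¬ b] is nonzero, some multiple of it is 1. By [prelinear], subtracting that multiple
    leaves [b ⊙ ¬ a] unchanged, yet subtracting 1 gives 0. *)
Lemma simple_total a b : mv_le a b \/ mv_le b a.
Proof.
  destruct (classic (a ⊙ ¬ b = mv_zero)) as [H|H]; [left; apply le_times0, H|right].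
  destruct (simple _ H) as [n Hn].
  assert (E : forall k, b ⊙ ¬ a ⊙ ¬ mv_nmul k (a ⊙ ¬ b) = b ⊙ ¬ a).
  { induction k as [|k IH]; [apply times_1r|].
    change (mv_nmul (S k) (a ⊙ ¬ b)) with (a ⊙ ¬ b ⊕ mv_nmul k (a ⊙ ¬ b)).
    rewrite neg_oplus, times_assoc, prelinear. exact IH. }
  specialize (E n). rewrite Hn, neg_one, times_0r in E. apply le_times0; auto.
Qed.

Lemma simple_disjoint a b : a ⊕ b <> mv_one -> a ⊙ b = mv_zero.
Proof.
  intro H. destruct (simple_total a (¬ b)) as [L|L].
  - apply le_times0 in L. rewrite mv_negK in L; exact L.
  - elim H. unfold mv_le in L. rewrite mv_negK, mv_comm in L; exact L.
Qed.

Lemma times_neq_one a b : a <> mv_one -> a ⊙ b <> mv_one.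
Proof. intros H E. apply H, one_le. rewrite <- E. apply times_le_l. Qed.

(* A pair [(n, a)] stands for n + a in the totally ordered group generated by
   [A]; the sum carries a unit whenever [a ⊕ b] saturates. *)
Definition carry a b : nat := if excluded_middle_informative (a ⊕ b = mv_one) then 1 else 0.
Definition frac_sum a b : A :=
  if excluded_middle_informative (a ⊕ b = mv_one) then a ⊙ b else a ⊕ b.
Definition chang_add (x y : nat * A) : nat * A :=
  (fst x + fst y + carry (snd x) (snd y), frac_sum (snd x) (snd y))%nat.

Lemma chang_add_comm x y : chang_add x y = chang_add y x.
Proof.
  unfold chang_add, carry, frac_sum.
  rewrite (mv_comm _ (snd x)), (times_comm (snd x)), (Nat.add_comm (fst x)); reflexivity.
Qed.

(** Integer and fractional parts of the associativity of [chang_add], by cases on which of [a ⊕ b]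
    and [b ⊕ c] saturate. The mixed cases need [oplus_times_exchange]. *)
Lemma frac_assoc a b c :
  (carry a b + carry (frac_sum a b) c = carry b c + carry a (frac_sum b c))%nat /\
  frac_sum (frac_sum a b) c = frac_sum a (frac_sum b c).
Proof.
  unfold frac_sum, carry.
  destruct (excluded_middle_informative (a ⊕ b = mv_one)) as [Hab|Hab],
    (excluded_middle_informative (b ⊕ c = mv_one)) as [Hbc|Hbc].
  - rewrite (oplus_assoc_codisjoint a b c), times_assoc by assumption.
    destruct excluded_middle_informative; auto.
  - assert (E : a ⊙ b ⊕ c = a ⊙ (b ⊕ c)).
    { pose proof (oplus_times_exchange c b a) as X.
      rewrite times_comm, (mv_comm _ b a) in X.
      specialize (X (simple_disjoint _ _ Hbc) Hab).
      rewrite mv_comm, (times_comm a b), <- X, times_comm, (mv_comm _ c); reflexivity. }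
    rewrite E, (mv_assoc _ a), Hab, oplus_1l.
    destruct excluded_middle_informative as [F|F];
      [|destruct excluded_middle_informative; [auto|congruence]].
    rewrite times_comm in F. elim (times_neq_one _ a Hbc F).
  - assert (E : (a ⊕ b) ⊙ c = a ⊕ b ⊙ c)
      by (apply oplus_times_exchange; [apply simple_disjoint|]; assumption).
    rewrite <- E, <- (mv_assoc _ a b c), Hbc, oplus_1r.
    destruct excluded_middle_informative; [|congruence].
    destruct excluded_middle_informative as [F|F]; [|auto].
    elim (times_neq_one _ c Hab F).
  - rewrite (mv_assoc _ a b c).
    destruct excluded_middle_informative; [|auto].
    split; [reflexivity|]. apply times_assoc_disjoint; apply simple_disjoint; assumption.
Qed.

Lemma chang_add_assoc x y z :
  chang_add (chang_add x y) z = chang_add x (chang_add y z).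
Proof.
  destruct x as [i a], y as [j b], z as [k c]; unfold chang_add; cbn [fst snd].
  destruct (frac_assoc a b c) as [E F]. rewrite F; f_equal; lia.
Qed.

(** Multiplication by [2 ^ n] in the ordered group, with the integer part gathering the carries. *)
Definition doubling (n : nat) (x : nat * A) : nat * A := Nat.iter n (fun y => chang_add y y) x.

Lemma doubling_S n x : doubling (S n) x = chang_add (doubling n x) (doubling n x).
Proof. reflexivity. Qed.

Lemma doubling_add n x y :
  doubling n (chang_add x y) = chang_add (doubling n x) (doubling n y).
Proof.
  induction n as [|n IH]; [reflexivity|]. rewrite !doubling_S, IH.
  generalize (doubling n x) (doubling n y); intros u v.
  rewrite !chang_add_assoc; f_equal.
  rewrite <- !chang_add_assoc, (chang_add_comm v u); reflexivity.
Qed.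

Lemma carry_le a b : (carry a b <= 1)%nat.
Proof. unfold carry; destruct excluded_middle_informative; lia. Qed.

Lemma doubling_shift n k x :
  doubling n (k + fst x, snd x)%nat = (2 ^ n * k + fst (doubling n x), snd (doubling n x))%nat.
Proof.
  induction n as [|n IH]; [destruct x; cbn; f_equal; lia|].
  rewrite !doubling_S, IH. unfold chang_add; cbn [fst snd]. f_equal. cbn; lia.
Qed.

Lemma doubling_bounds n x :
  (2 ^ n * fst x <= fst (doubling n x) < 2 ^ n * (fst x + 1))%nat.
Proof.
  induction n as [|n IH]; [cbn; lia|].
  rewrite doubling_S. cbn [chang_add fst].
  pose proof (carry_le (snd (doubling n x)) (snd (doubling n x))). cbn; lia.
Qed.

Lemma pow2_pos n : 0 < 2 ^ n.
Proof. apply pow_lt; lra. Qed.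

(* The value of [x] has the successive integer parts [fst (doubling n x) / 2^n]
   as its binary expansion. *)
Lemma chang_value_ex x :
  exists r, forall n, INR (fst (doubling n x)) <= r * 2 ^ n <= INR (fst (doubling n x)) + 1.
Proof.
  (* Every lower estimate of the value is at most every upper one, with denominators cleared; the
     supremum of the lower estimates therefore meets all bounds. *)
  assert (Hcmp : forall n m,
    INR (fst (doubling n x)) * 2 ^ m <= (INR (fst (doubling m x)) + 1) * 2 ^ n).
  { intros n m.
    assert (P : forall d k, doubling (d + k) x = doubling d (doubling k x)).
    { intros d k; unfold doubling; rewrite Nat.iter_add; reflexivity. }
    destruct (Nat.le_ge_cases n m) as [L|L].
    - pose proof (doubling_bounds (m - n) (doubling n x)) as [B _].
      rewrite <- P in B. replace (m - n + n)%nat with m in B by lia.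
      apply le_INR in B. rewrite mult_INR, pow_INR in B.
      replace (2 ^ m) with (2 ^ (m - n) * 2 ^ n) by (rewrite <- pow_add; f_equal; lia).
      pose proof (pow2_pos n). pose proof (pow2_pos (m - n)). change (INR 2) with 2 in B.
      rewrite <- Rmult_assoc. apply Rmult_le_compat_r; [lra|]. lra.
    - pose proof (doubling_bounds (n - m) (doubling m x)) as [_ B].
      rewrite <- P in B. replace (n - m + m)%nat with n in B by lia.
      apply lt_INR in B. rewrite mult_INR, pow_INR, plus_INR in B.
      replace (2 ^ n) with (2 ^ (n - m) * 2 ^ m) by (rewrite <- pow_add; f_equal; lia).
      pose proof (pow2_pos m). pose proof (pow2_pos (n - m)).
      change (INR 2) with 2 in B; change (INR 1) with 1 in B.
      rewrite <- Rmult_assoc. apply Rmult_le_compat_r; [lra|]. lra. }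
  destruct (completeness (fun r => exists n, r * 2 ^ n <= INR (fst (doubling n x))))
    as [r [Hub Hlub]].
  - exists (INR (fst x) + 1). intros s [n Hn]. specialize (Hcmp n 0%nat).
    change (doubling 0 x) with x in Hcmp. rewrite pow_O in Hcmp. pose proof (pow2_pos n).
    apply Rmult_le_reg_r with (2 ^ n); lra.
  - exists (INR (fst x)), 0%nat. change (doubling 0 x) with x; rewrite pow_O; lra.
  - exists r; intro n; pose proof (pow2_pos n); split.
    + apply Rmult_le_reg_r with (/ 2 ^ n); [apply Rinv_0_lt_compat; lra|].
      rewrite Rmult_assoc, Rinv_r, Rmult_1_r by lra.
      apply Hub. exists n. rewrite Rmult_assoc, Rinv_l by lra; lra.
    + apply Rmult_le_reg_r with (/ 2 ^ n); [apply Rinv_0_lt_compat; lra|].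
      rewrite Rmult_assoc, Rinv_r, Rmult_1_r by lra.
      apply Hlub. intros s [m Hm]. specialize (Hcmp m n). pose proof (pow2_pos m).
      apply Rmult_le_reg_r with (2 ^ n); [lra|].
      rewrite Rmult_assoc, Rinv_l by lra.
      apply Rmult_le_reg_r with (2 ^ m); [lra|]. nra.
Qed.

Lemma pow2_small r : (forall n, r * 2 ^ n <= 4) -> r <= 0.
Proof.
  intro H. destruct (Rle_lt_dec r 0) as [L|L]; [exact L|].
  destruct (Pow_x_infinity 2 ltac:(rewrite Rabs_right; lra) (5 / r)) as [n Hn].
  specialize (Hn n (le_n n)). rewrite Rabs_right in Hn by (apply Rle_ge, pow_le; lra).
  specialize (H n). apply Rge_le in Hn.
  apply (Rmult_le_compat_l r) in Hn; [|lra].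
  replace (r * (5 / r)) with 5 in Hn by (field; lra). lra.
Qed.

(** The value map is additive on pairs, and the two cases of [frac_sum] turn this into truncated
    addition on [A]. *)
Lemma simple_embedding :
  exists h : A -> R, mv_hom_unit h /\ forall a, h a = 0 <-> a = mv_zero.
Proof.
  destruct (choice _ chang_value_ex) as [v Hv].
  set (h := fun a => v (0%nat, a)).
  assert (Hadd : forall a b, h a + h b = INR (carry a b) + h (frac_sum a b)).
  { intros a b. set (c := frac_sum a b).
    (* Three roundings and one carry, each of size at most 1, bound the defect times [2 ^ n] by 4
       for every [n], which forces the defect to be 0. *)
    assert (Hb : forall n, -4 <= (h a + h b - INR (carry a b) - h c) * 2 ^ n <= 4).
    { intro n. pose proof (Hv (0%nat, a) n) as Ha. pose proof (Hv (0%nat, b) n) as Hb.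
      pose proof (Hv (0%nat, c) n) as Hc. fold (h a) in Ha. fold (h b) in Hb. fold (h c) in Hc.
      pose proof (doubling_add n (0%nat, a) (0%nat, b)) as E.
      unfold chang_add at 1 in E; cbn [fst snd] in E. fold c in E.
      pose proof (doubling_shift n (carry a b) (0%nat, c)) as F. cbn [fst snd] in F.
      rewrite Nat.add_0_r in F. rewrite Nat.add_0_l, F in E.
      apply (f_equal fst) in E. cbn [fst chang_add] in E.
      pose proof (carry_le (snd (doubling n (0%nat, a))) (snd (doubling n (0%nat, b)))) as K.
      apply le_INR in K. pose proof (pos_INR (carry (snd (doubling n (0%nat, a)))
        (snd (doubling n (0%nat, b))))).
      apply (f_equal INR) in E. rewrite !plus_INR, mult_INR, pow_INR in E.
      change (INR 2) with 2 in E. change (INR 1) with 1 in K. nra. }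
    assert (h a + h b - INR (carry a b) - h c <= 0) by (apply pow2_small; intro n; apply Hb).
    assert (- (h a + h b - INR (carry a b) - h c) <= 0).
    { apply pow2_small; intro n. destruct (Hb n); lra. }
    lra. }
  assert (Hsat : forall a b, a ⊕ b = mv_one -> h a + h b = 1 + h (a ⊙ b)).
  { intros a b E. rewrite Hadd. unfold carry, frac_sum.
    destruct excluded_middle_informative; [reflexivity|contradiction]. }
  assert (Huns : forall a b, a ⊕ b <> mv_one -> h a + h b = h (a ⊕ b)).
  { intros a b E. rewrite Hadd. unfold carry, frac_sum.
    destruct excluded_middle_informative; [contradiction|]. cbn; lra. }
  assert (Hpos : forall a, 0 <= h a <= 1).
  { intro a. pose proof (Hv (0%nat, a) 0%nat) as [H1 H2]. change (doubling 0 (0%nat, a)) with (0%nat, a) in H1, H2.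
    rewrite pow_O in H1, H2. cbn in H1, H2.
    fold (h a) in H1, H2. lra. }
  assert (H1 : h mv_one = 1).
  { pose proof (Hsat mv_one mv_one (oplus_1r _)) as E. rewrite times_1r in E; lra. }
  assert (H0 : h mv_zero = 0).
  { pose proof (Huns mv_zero mv_zero) as E. rewrite oplus_0r in E. specialize (E nontrivial).
    lra. }
  assert (Hhom : mv_hom_unit h).
  { repeat split; try apply Hpos; auto.
    - intros a b. destruct (classic (a ⊕ b = mv_one)) as [E|E].
      + rewrite E, H1, Rmin_left; [reflexivity|].
        rewrite (Hsat _ _ E). destruct (Hpos (a ⊙ b)); lra.
      + rewrite Rmin_right; [symmetry; apply Huns, E|].
        rewrite (Huns _ _ E). apply Hpos.
    - intro a. pose proof (Hsat a (¬ a) (oplus_negr a)) as E. rewrite times_negr in E; lra. }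
  exists h; split; [exact Hhom|]. intro a; split; [|intros ->; exact H0].
  intro Ha. destruct (classic (a = mv_zero)) as [E|E]; [exact E|exfalso].
  destruct (simple a E) as [n Hn].
  assert (Z : forall k, h (mv_nmul k a) = 0).
  { induction k as [|k IH]; [exact H0|].
    change (mv_nmul (S k) a) with (a ⊕ mv_nmul k a).
    destruct Hhom as [_ [_ [Hp _]]]. rewrite Hp, IH, Ha, Rmin_right; lra. }
  specialize (Z n). rewrite Hn in Z; lra.
Qed.

End Simple.

(** * Ideals and the maximal spectrum *)

Fixpoint mv_sum {M : MVAlgebra} (l : list M) : M :=
  match l with nil => mv_zero | a :: l => a ⊕ mv_sum l end.

Lemma mv_sum_app {M : MVAlgebra} (l l' : list M) : mv_sum (l ++ l') = mv_sum l ⊕ mv_sum l'.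
Proof.
  induction l as [|a l IH]; cbn; [rewrite oplus_0l|rewrite IH, mv_assoc]; reflexivity.
Qed.

Lemma mv_sum_ideal {M : MVAlgebra} (I : M -> Prop) (l : list M) :
  is_ideal I -> (forall a, In a l -> I a) -> I (mv_sum l).
Proof.
  intros [H0 [_ Hplus]]. induction l as [|a l IH]; intro H; [exact H0|].
  apply Hplus; [apply H; left|apply IH; intros; apply H; right]; auto.
Qed.

Definition gen_ideal {M : MVAlgebra} (S : M -> Prop) (a : M) : Prop :=
  exists l, (forall x, In x l -> S x) /\ mv_le a (mv_sum l).

Lemma gen_ideal_is_ideal {M : MVAlgebra} (S : M -> Prop) : is_ideal (gen_ideal S).
Proof.
  split; [|split].
  - exists nil; split; [intros x []|apply le_refl].
  - intros a b Hab [l [Hl Hb]]. exists l; split; [exact Hl|apply (le_trans b); assumption].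
  - intros a b [l [Hl Ha]] [l' [Hl' Hb]]. exists (l ++ l'); split.
    + intros x Hx; apply in_app_or in Hx; destruct Hx; auto.
    + rewrite mv_sum_app; apply oplus_mono2; assumption.
Qed.

Lemma gen_ideal_incl {M : MVAlgebra} (S : M -> Prop) a : S a -> gen_ideal S a.
Proof.
  intro H; exists (a :: nil); split.
  - intros x [<-|[]]; exact H.
  - cbn; rewrite oplus_0r; apply le_refl.
Qed.

Lemma gen_ideal_one {M : MVAlgebra} (S : M -> Prop) :
  gen_ideal S mv_one -> exists l, (forall x, In x l -> S x) /\ mv_sum l = mv_one.
Proof. intros [l [Hl H]]; exists l; split; [exact Hl|apply one_le, H]. Qed.

(** Zorn's lemma on the proper ideals above [I]; the union of a chain stays proper because 1 would
    already lie in a member. *)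
Lemma maximal_ideal_exists (M : MVAlgebra) (I : M -> Prop) :
  is_proper_ideal I -> exists m : MaxSpec M, forall a, I a -> proj1_sig m a.
Proof.
  intro HI.
  set (T := {J : M -> Prop | is_proper_ideal J /\ forall a, I a -> J a}).
  set (leT := fun J K : T => forall a, proj1_sig J a -> proj1_sig K a).
  set (I0 := exist _ I (conj HI (fun a H => H)) : T).
  destruct (@classical_sets.ZL_preorder T I0
    (fun J K => boolp.asbool (leT J K))) as [[m [Hm HIm]] Hmax].
  - intro J. rewrite boolp.asboolE. intros a; trivial.
  - intros J K L. rewrite !boolp.asboolE. intros H H' a Ha; apply H', H, Ha.
  - intros C HC.
    destruct (classic (exists J, C J)) as [[J0 HJ0]|HE].
    (* The empty chain also needs an upper bound, for which [I] itself serves. *)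
    2:{ exists I0. intros J HJ; elim HE; exists J; exact HJ. }
    assert (Hdir : forall J K, C J -> C K -> leT J K \/ leT K J).
    { intros J K HJ HK. specialize (HC J K HJ HK). cbv beta in HC. rewrite !boolp.asboolE in HC.
      exact HC. }
    set (U := fun a => exists J, C J /\ proj1_sig J a).
    assert (HU : is_proper_ideal U /\ forall a, I a -> U a).
    { split; [split; [split; [|split]|]|].
      - exists J0; split; [exact HJ0|]. exact (proj1 (proj1 (proj1 (proj2_sig J0)))).
      - intros a b Hab [J [HJ Hb]]. exists J; split; [exact HJ|].
        destruct (proj2_sig J) as [[[_ [Hle _]] _] _]. apply (Hle a b); assumption.
      - intros a b [J [HJ Ha]] [K [HK Hb]].
        destruct (Hdir J K HJ HK) as [H|H].
        + exists K; split; [exact HK|].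
          destruct (proj2_sig K) as [[[_ [_ Hp]] _] _]. apply Hp; [apply H|]; assumption.
        + exists J; split; [exact HJ|].
          destruct (proj2_sig J) as [[[_ [_ Hp]] _] _]. apply Hp; [|apply H]; assumption.
      - intros [J [_ H1]]. destruct (proj2_sig J) as [[_ Hn] _]. exact (Hn H1).
      - intros a Ha. exists J0; split; [exact HJ0|]. exact (proj2 (proj2_sig J0) a Ha). }
    exists (exist _ U HU). intros J HJ. rewrite boolp.asboolE. intros a Ha. exists J; auto.
  - assert (Hmx : is_maximal_ideal m).
    { split; [exact Hm|]. intros J HJ HmJ.
      specialize (Hmax (exist _ J (conj HJ (fun a H => HmJ a (HIm a H))))).
      cbv beta in Hmax. rewrite !boolp.asboolE in Hmax. exact (Hmax HmJ). }
    exists (exist _ m Hmx). exact HIm.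
Qed.

(* Compactness of the maximal spectrum. *)
Lemma spectrum_cover (M : MVAlgebra) (S : M -> Prop) :
  (forall m : MaxSpec M, exists a, S a /\ ~ proj1_sig m a) ->
  exists l, (forall x, In x l -> S x) /\ mv_sum l = mv_one.
Proof.
  intro H. apply gen_ideal_one.
  destruct (classic (gen_ideal S mv_one)) as [G|G]; [exact G|].
  destruct (maximal_ideal_exists M (gen_ideal S)) as [m Hm].
  - split; [apply gen_ideal_is_ideal|exact G].
  - destruct (H m) as [a [Ha Hna]]. elim Hna. apply Hm, gen_ideal_incl, Ha.
Qed.

(** By maximality the ideal generated by [m] and [a] contains 1, and a finite sum equal to 1 sorts
    into copies of [a] and a part in [m]. In the quotient this is the hypothesis [simple]. *)
Lemma maximal_archimedean (M : MVAlgebra) (m : M -> Prop) a :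
  is_maximal_ideal m -> ~ m a -> exists n c, m c /\ mv_nmul n a ⊕ c = mv_one.
Proof.
  intros [[HI _] Hmax] Ha.
  set (S := fun x => m x \/ x = a).
  destruct (classic (gen_ideal S mv_one)) as [G|G].
  - apply gen_ideal_one in G. destruct G as [l [Hl Hl1]].
    assert (E : forall l', (forall x, In x l' -> S x) ->
      exists n c, m c /\ mv_sum l' = mv_nmul n a ⊕ c).
    { induction l' as [|x l' IH]; intro H'.
      - exists 0%nat, mv_zero; split; [apply HI|]. symmetry; apply oplus_0r.
      - destruct IH as [n [c [Hc E]]]; [intros; apply H'; right; assumption|].
        destruct (H' x (or_introl eq_refl)) as [Hx|Hx].
        + exists n, (x ⊕ c); split; [apply HI; assumption|].
          cbn; rewrite E; apply oplus_ac.
        + subst x. exists (Datatypes.S n), c; split; [exact Hc|].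
          cbn; rewrite E; apply mv_assoc. }
    destruct (E l Hl) as [n [c [Hc F]]]. exists n, c; split; [exact Hc|congruence].
  - elim Ha. apply (Hmax (gen_ideal S)).
    + split; [apply gen_ideal_is_ideal|exact G].
    + intros x Hx; apply gen_ideal_incl; left; exact Hx.
    + apply gen_ideal_incl; right; reflexivity.
Qed.

(** Justifies the choice in [hstar]: the quotient by [m] is simple, and composing with
    [simple_embedding] gives the required homomorphism. *)
Lemma hstar_spec (M : MVAlgebra) (m : MaxSpec M) :
  mv_hom_unit (hstar m) /\ forall a, hstar m a = 0 <-> proj1_sig m a.
Proof.
  unfold hstar. apply epsilon_spec.
  destruct m as [m Hm]; cbn. pose proof Hm as [[HI Hp] _].
  destruct (ideal_quotient M m HI) as [Q [f [[F0 [Fp Fn]] [Hsurj Hker]]]].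
  assert (Fm : forall n a, f (mv_nmul n a) = mv_nmul n (f a)).
  { intros n a; induction n as [|n IH]; [exact F0|].
    change (mv_nmul (S n) a) with (a ⊕ mv_nmul n a). rewrite Fp, IH; reflexivity. }
  assert (F1 : f mv_one = mv_one) by (unfold mv_one; rewrite Fn, F0; reflexivity).
  destruct (@simple_embedding Q) as [h [[Hr [H0 [Hplus Hneg]]] Hk]].
  - rewrite <- F1. intro E. apply Hp, Hker; auto.
  - intros x Hx. destruct (Hsurj x) as [a ->].
    destruct (maximal_archimedean M m a Hm) as [n [c [Hc E]]].
    + rewrite <- Hker; exact Hx.
    + exists n. apply Hker in Hc. rewrite <- Fm, <- F1, <- E, Fp, Hc, oplus_0r; reflexivity.
  - exists (fun a => h (f a)). split; [split; [|split; [|split]]|].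
    + intro; apply Hr.
    + rewrite F0; exact H0.
    + intros; rewrite Fp; apply Hplus.
    + intros; rewrite Fn; apply Hneg.
    + intro a. rewrite Hk; apply Hker.
Qed.

(** * Gelfand transforms *)

Section UnitHom.
Context {M : MVAlgebra} (h : M -> R).
Hypothesis Hh : mv_hom_unit h.

Lemma hom_bounds a : 0 <= h a <= 1.
Proof. apply Hh. Qed.

Lemma hom_zero : h mv_zero = 0.
Proof. apply Hh. Qed.

Lemma hom_oplus a b : h (a ⊕ b) = Rmin 1 (h a + h b).
Proof. apply Hh. Qed.

Lemma hom_neg a : h (¬ a) = 1 - h a.
Proof. apply Hh. Qed.

Lemma hom_one : h mv_one = 1.
Proof. unfold mv_one; rewrite hom_neg, hom_zero; lra. Qed.

Lemma hom_times a b : h (a ⊙ b) = Rmax 0 (h a + h b - 1).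
Proof.
  unfold mv_times. rewrite hom_neg, hom_oplus, !hom_neg.
  unfold Rmin, Rmax; repeat destruct Rle_dec; lra.
Qed.

Lemma hom_meet a b : h (mv_meet a b) = Rmin (h a) (h b).
Proof.
  unfold mv_meet, mv_join. repeat rewrite ?hom_neg, ?hom_oplus.
  pose proof (hom_bounds a); pose proof (hom_bounds b).
  unfold Rmin; repeat destruct Rle_dec; lra.
Qed.

Lemma hom_mono a b : mv_le a b -> h a <= h b.
Proof.
  intro H; rewrite (le_decomp a b H), hom_oplus.
  pose proof (hom_bounds a); pose proof (hom_bounds (b ⊙ ¬ a)).
  unfold Rmin; destruct Rle_dec; lra.
Qed.

End UnitHom.

Lemma hstar_hom {M : MVAlgebra} (m : MaxSpec M) : mv_hom_unit (hstar m).
Proof. apply hstar_spec. Qed.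

Lemma hstar_zero_iff {M : MVAlgebra} (m : MaxSpec M) a : hstar m a = 0 <-> proj1_sig m a.
Proof. apply hstar_spec. Qed.

Lemma hstar_pos_iff {M : MVAlgebra} (m : MaxSpec M) a : 0 < hstar m a <-> ~ proj1_sig m a.
Proof.
  rewrite <- hstar_zero_iff. pose proof (hom_bounds _ (hstar_hom m) a). split; intro; lra.
Qed.

(** The transform of [a ⊙ ¬ b] vanishes everywhere. This allows identities in a semisimple algebra
    to be checked as identities of reals. *)
Lemma semisimple_le {M : MVAlgebra} (a b : M) : semisimple M ->
  (forall m, hstar m a <= hstar m b) -> mv_le a b.
Proof.
  intros HM H. apply le_times0, HM. intro m. apply hstar_zero_iff.
  rewrite hom_times, hom_neg by apply hstar_hom. rewrite Rmax_left; [reflexivity|].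
  specialize (H m); lra.
Qed.

Lemma semisimple_eq {M : MVAlgebra} (a b : M) : semisimple M ->
  (forall m, hstar m a = hstar m b) -> a = b.
Proof.
  intros HM H; apply le_antisym; apply semisimple_le; trivial; intro m; rewrite H; lra.
Qed.

(** * Good sequences of finite sums *)

Fixpoint total {M : MVAlgebra} (w : M -> R) (l : list M) : R :=
  match l with nil => 0 | a :: l => w a + total w l end.

(* [level l i] is the [i]-th term of the good sequence of the sum of [l]: its
   transform is the truncation to [0,1] of (sum of the transforms of [l]) - i. *)
Fixpoint level {M : MVAlgebra} (l : list M) (i : nat) : M :=
  match l with
  | nil => mv_zero
  | a :: l => match i with
              | O => level l O ⊕ a
              | S j => level l i ⊕ a ⊙ level l j
              end
  end.

Lemma hstar_level {M : MVAlgebra} (m : MaxSpec M) (l : list M) (i : nat) :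
  hstar m (level l i) = Rmax 0 (Rmin 1 (total (hstar m) l - INR i)).
Proof.
  (* Matters at index 0, where clipping the sum below at 0 must not change it. *)
  assert (Hnn : forall l, 0 <= total (hstar m) l).
  { induction l0 as [|a l0 IH]; cbn; [lra|].
    pose proof (hom_bounds _ (hstar_hom m) a); lra. }
  revert i; induction l as [|a l IH]; intro i.
  - cbn. rewrite hom_zero by apply hstar_hom. pose proof (pos_INR i).
    unfold Rmin, Rmax; repeat destruct Rle_dec; lra.
  - pose proof (hom_bounds _ (hstar_hom m) a). specialize (Hnn l).
    destruct i as [|i]; cbn [level total].
    + rewrite hom_oplus, IH by apply hstar_hom. cbn [INR].
      unfold Rmin, Rmax; repeat destruct Rle_dec; lra.
    + rewrite hom_oplus, hom_times, !IH, S_INR by apply hstar_hom.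
      unfold Rmin, Rmax; repeat destruct Rle_dec; lra.
Qed.

Lemma total_repeat {M : MVAlgebra} (w : M -> R) a n : total w (repeat a n) = INR n * w a.
Proof.
  induction n as [|n IH]; cbn [repeat total]; [cbn; lra|rewrite IH, S_INR; lra].
Qed.

Lemma total_app {M : MVAlgebra} (w : M -> R) l l' : total w (l ++ l') = total w l + total w l'.
Proof. induction l as [|a l IH]; cbn; [lra|rewrite IH; lra]. Qed.

(** * Continuity for the hull-kernel topology *)

(** The sets of maximal ideals omitting a given element form a basis of the topology, so a
    neighbourhood can be named by an element of [M]. *)
Lemma hk_continuous_iff {M : MVAlgebra} (f : MaxSpec M -> R) :
  hk_continuous f <->
  forall x eps, 0 < eps ->
    exists a, ~ proj1_sig x a /\ forall y, ~ proj1_sig y a -> Rabs (f y - f x) < eps.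
Proof.
  split.
  - intros Hf x eps He. destruct (Hf (disc (f x) (mkposreal eps He)) (disc_P1 _ _)) as [S HS].
    destruct (proj1 (HS x)) as [a [Ha Hx]].
    + unfold disc; rewrite Rminus_diag, Rabs_R0; exact He.
    + exists a; split; [exact Hx|]. intros y Hy. apply (HS y). exists a; auto.
  - intros H U HU. exists (fun a => forall y, ~ proj1_sig y a -> U (f y)). intro x; split.
    + intro Hx. destruct (HU _ Hx) as [[eps He] Hd].
      destruct (H x eps He) as [a [Ha Hy]]. exists a; split; [|exact Ha].
      intros y Hya; apply Hd, Hy, Hya.
    + intros [a [Ha Hx]]; apply Ha, Hx.
Qed.

Lemma max_meet_notin {M : MVAlgebra} (x : MaxSpec M) a b :
  ~ proj1_sig x (mv_meet a b) <-> ~ proj1_sig x a /\ ~ proj1_sig x b.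
Proof.
  rewrite <- !hstar_pos_iff, hom_meet by apply hstar_hom.
  unfold Rmin; destruct Rle_dec; split; intros; lra.
Qed.

Lemma hk_continuous_const {M : MVAlgebra} (c : R) : hk_continuous (fun _ : MaxSpec M => c).
Proof.
  apply hk_continuous_iff. intros x eps He. exists mv_one; split; [apply (proj2_sig x)|].
  intros; rewrite Rminus_diag, Rabs_R0; exact He.
Qed.

Lemma hk_continuous_plus {M : MVAlgebra} (f g : MaxSpec M -> R) :
  hk_continuous f -> hk_continuous g -> hk_continuous (fun x => f x + g x).
Proof.
  rewrite !hk_continuous_iff. intros Hf Hg x eps He.
  destruct (Hf x (eps / 2)) as [a [Ha Ha']]; [lra|].
  destruct (Hg x (eps / 2)) as [b [Hb Hb']]; [lra|].
  exists (mv_meet a b); split; [apply max_meet_notin; auto|].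
  intros y Hy; apply max_meet_notin in Hy; destruct Hy as [Hya Hyb].
  specialize (Ha' y Hya); specialize (Hb' y Hyb).
  apply Rabs_def2 in Ha', Hb'. apply Rabs_def1; lra.
Qed.

Lemma hk_continuous_scale {M : MVAlgebra} (c : R) (f : MaxSpec M -> R) :
  hk_continuous f -> hk_continuous (fun x => c * f x).
Proof.
  rewrite !hk_continuous_iff. intros Hf x eps He.
  pose proof (Rabs_pos c).
  destruct (Hf x (eps / (Rabs c + 1))) as [a [Ha Ha']]; [apply Rdiv_lt_0_compat; lra|].
  exists a; split; [exact Ha|]. intros y Hy. specialize (Ha' y Hy).
  rewrite <- Rmult_minus_distr_l, Rabs_mult.
  apply (Rmult_lt_compat_r (Rabs c + 1)) in Ha'; [|lra].
  unfold Rdiv in Ha'. rewrite Rmult_assoc, Rinv_l in Ha' by lra.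
  pose proof (Rabs_pos (f y - f x)). nra.
Qed.

Lemma Rabs_le_bounds x e : Rabs x <= e <-> - e <= x <= e.
Proof. unfold Rabs; destruct Rcase_abs; lra. Qed.

Lemma hk_continuous_uniform_limit {M : MVAlgebra} (f : MaxSpec M -> R) :
  (forall eps, 0 < eps -> exists g, hk_continuous g /\ forall x, Rabs (g x - f x) <= eps) ->
  hk_continuous f.
Proof.
  intro H. apply hk_continuous_iff. intros x eps He.
  destruct (H (eps / 4)) as [g [Hg Hgf]]; [lra|].
  rewrite hk_continuous_iff in Hg. destruct (Hg x (eps / 4)) as [a [Ha Ha']]; [lra|].
  exists a; split; [exact Ha|]. intros y Hy. specialize (Ha' y Hy).
  pose proof (Hgf x) as Hx; pose proof (Hgf y) as Hy'.
  apply Rabs_def2 in Ha'. apply Rabs_le_bounds in Hx, Hy'. apply Rabs_def1; lra.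
Qed.

Lemma nat_floor_strict r : 0 < r -> exists j, INR j < r <= INR j + 1.
Proof.
  intro Hr. destruct (INR_unbounded r) as [N HN]. apply Rlt_le in HN.
  induction N as [|N IH]; [cbn in HN; lra|].
  destruct (Rle_lt_dec r (INR N)) as [L|L]; [exact (IH L)|].
  exists N; rewrite S_INR in HN; lra.
Qed.

(** For n > 1 / eps take j with j < n [star a x] <= j + 1. Level j of n copies of [a] is nonzero at
    [y] exactly when n [star a y] > j, and then [star a y] > [star a x] - 1/n. *)
Lemma star_lower_semicontinuous {M : MVAlgebra} (a : M) (x : MaxSpec M) eps : 0 < eps ->
  exists b, ~ proj1_sig x b /\ forall y, ~ proj1_sig y b -> star a x - eps < star a y.
Proof.
  unfold star. intro He. pose proof (hom_bounds _ (hstar_hom x) a) as Hx.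
  destruct (Rle_lt_dec (hstar x a) 0) as [Z|Z].
  - exists mv_one; split; [apply (proj2_sig x)|]. intros y _.
    pose proof (hom_bounds _ (hstar_hom y) a); lra.
  - destruct (INR_unbounded (/ eps)) as [n Hn].
    pose proof (Rinv_0_lt_compat _ He) as He'.
    destruct (nat_floor_strict (INR n * hstar x a)) as [j Hj]; [nra|].
    exists (level (repeat a n) j). rewrite <- hstar_pos_iff, hstar_level, total_repeat.
    split; [unfold Rmin, Rmax; repeat destruct Rle_dec; lra|].
    intro y. rewrite <- hstar_pos_iff, hstar_level, total_repeat. intro Hy.
    assert (Hy' : INR j < INR n * hstar y a)
      by (revert Hy; unfold Rmin, Rmax; repeat destruct Rle_dec; lra).
    assert (1 < INR n * eps).
    { apply (Rmult_lt_compat_r eps) in Hn; [|exact He]. rewrite Rinv_l in Hn; lra. }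
    nra.
Qed.

(** Upper semicontinuity for [a] is lower semicontinuity for [¬ a]. *)
Lemma star_continuous {M : MVAlgebra} (a : M) : hk_continuous (star a).
Proof.
  apply hk_continuous_iff. intros x eps He.
  destruct (star_lower_semicontinuous a x eps He) as [b [Hb Hb']].
  destruct (star_lower_semicontinuous (¬ a) x eps He) as [c [Hc Hc']].
  exists (mv_meet b c); split; [apply max_meet_notin; auto|].
  intros y Hy; apply max_meet_notin in Hy; destruct Hy as [Hyb Hyc].
  specialize (Hb' y Hyb); specialize (Hc' y Hyc). unfold star in *.
  rewrite !hom_neg in Hc' by apply hstar_hom. apply Rabs_def1; lra.
Qed.

(** * Compactness and uniform density of the span of the transforms *)

Lemma hk_continuous_bounded {M : MVAlgebra} (f : MaxSpec M -> R) :
  hk_continuous f -> exists B, forall x, Rabs (f x) <= B.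
Proof.
  rewrite hk_continuous_iff. intro Hf.
  destruct (spectrum_cover M (fun a => exists B, forall y, ~ proj1_sig y a -> Rabs (f y) <= B))
    as [l [Hl Hl1]].
  - intro x. destruct (Hf x 1 Rlt_0_1) as [a [Ha Ha']]. exists a; split; [|exact Ha].
    exists (Rabs (f x) + 1). intros y Hy. specialize (Ha' y Hy).
    pose proof (Rabs_triang (f y - f x) (f x)) as T.
    replace (f y - f x + f x) with (f y) in T by ring. lra.
  - assert (HB : exists B, forall a, In a l -> forall y, ~ proj1_sig y a -> Rabs (f y) <= B).
    { clear Hl1. induction l as [|a l IH]; [exists 0; intros a []|].
      destruct IH as [B HB]; [intros; apply Hl; right; assumption|].
      destruct (Hl a (or_introl eq_refl)) as [B' HB'].
      exists (Rmax B B'). intros b [<-|Hb] y Hy.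
      - apply Rle_trans with B'; [apply HB', Hy|apply Rmax_r].
      - apply Rle_trans with B; [apply (HB b); assumption|apply Rmax_l]. }
    destruct HB as [B HB]. exists B. intro x.
    destruct (classic (exists a, In a l /\ ~ proj1_sig x a)) as [[a [Ha Hx]]|HN].
    + apply (HB a); assumption.
    (* If [x] contained every element of [l], it would contain their sum 1. *)
    + exfalso. destruct (proj2_sig x) as [[HI Hp] _]. apply Hp. rewrite <- Hl1.
      apply mv_sum_ideal; [exact HI|]. intros a Ha.
      apply NNPP; intro Hx; apply HN; exists a; auto.
Qed.

(* The opens {f < t} and {s < f} cover the spectrum, so compactness writes 1 as
   the sum of an element vanishing on {t <= f} and one vanishing on {f <= s}. *)
Lemma urysohn {M : MVAlgebra} (f : MaxSpec M -> R) (s t : R) : hk_continuous f -> s < t ->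
  exists u : M, forall x, (f x <= s -> hstar x u = 0) /\ (t <= f x -> hstar x u = 1).
Proof.
  rewrite hk_continuous_iff. intros Hf Hst.
  set (P := fun a : M => forall y, t <= f y -> proj1_sig y a).
  set (Q := fun a : M => forall y, f y <= s -> proj1_sig y a).
  destruct (spectrum_cover M (fun a => P a \/ Q a)) as [l [Hl Hl1]].
  - intro x. destruct (Rle_lt_dec t (f x)) as [L|L].
    + destruct (Hf x (f x - s)) as [a [Ha Ha']]; [lra|].
      exists a; split; [right|exact Ha]. intros y Hy. apply NNPP; intro Hya.
      specialize (Ha' y Hya). apply Rabs_def2 in Ha'; lra.
    + destruct (Hf x (t - f x)) as [a [Ha Ha']]; [lra|].
      exists a; split; [left|exact Ha]. intros y Hy. apply NNPP; intro Hya.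
      specialize (Ha' y Hya). apply Rabs_def2 in Ha'; lra.
  - assert (E : exists u v, P u /\ Q v /\ mv_sum l = u ⊕ v).
    { clear Hl1. induction l as [|a l IH].
      - exists mv_zero, mv_zero; repeat split; [| |symmetry; apply oplus_0r];
          intros y _; apply (proj2_sig y).
      - destruct IH as [u [v [Hu [Hv E]]]]; [intros; apply Hl; right; assumption|].
        cbn [mv_sum]; rewrite E. destruct (Hl a (or_introl eq_refl)) as [Ha|Ha].
        + exists (a ⊕ u), v; repeat split; [|exact Hv|apply mv_assoc].
          intros y Hy. destruct (proj2_sig y) as [[[_ [_ Hp]] _] _]. apply Hp; auto.
        + exists u, (a ⊕ v); repeat split; [exact Hu| |apply oplus_ac].
          intros y Hy. destruct (proj2_sig y) as [[[_ [_ Hp]] _] _]. apply Hp; auto. }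
    destruct E as [u [v [Hu [Hv E]]]]. exists v. intro x; split; intro Hx.
    + apply hstar_zero_iff, Hv, Hx.
    + specialize (Hu x Hx). apply hstar_zero_iff in Hu.
      pose proof (hom_oplus _ (hstar_hom x) u v) as F.
      rewrite <- E, Hl1, hom_one, Hu in F by apply hstar_hom.
      pose proof (hom_bounds _ (hstar_hom x) v).
      revert F; unfold Rmin; destruct Rle_dec; lra.
Qed.

(** The weight [w] is left free, so that one formal combination can be evaluated under
    homomorphisms, states and operators alike. *)
Fixpoint lincomb {M : MVAlgebra} (w : M -> R) (phi : list (R * M)) : R :=
  match phi with nil => 0 | (c, a) :: phi => c * w a + lincomb w phi end.

Lemma lincomb_app {M : MVAlgebra} (w : M -> R) phi psi :
  lincomb w (phi ++ psi) = lincomb w phi + lincomb w psi.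
Proof. induction phi as [|[c a] phi IH]; cbn; [lra|rewrite IH; lra]. Qed.

Fixpoint lc_scale {M : MVAlgebra} (c : R) (phi : list (R * M)) : list (R * M) :=
  match phi with nil => nil | (d, a) :: phi => (c * d, a) :: lc_scale c phi end.

Lemma lincomb_scale {M : MVAlgebra} (w : M -> R) c phi :
  lincomb w (lc_scale c phi) = c * lincomb w phi.
Proof. induction phi as [|[d a] phi IH]; cbn; [lra|rewrite IH; lra]. Qed.

(** Stated for a map [p] to cover both spectra: approximants on [MaxSpec M] use the identity, their
    images on [MaxSpec N] the probability map. *)
Lemma lincomb_continuous {M N : MVAlgebra} (p : M -> N) (phi : list (R * M)) :
  hk_continuous (fun y => lincomb (fun a => hstar y (p a)) phi).
Proof.
  induction phi as [|[c a] phi IH]; [apply (hk_continuous_const 0)|].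
  apply (hk_continuous_plus (fun y => c * hstar y (p a))); [|exact IH].
  apply (hk_continuous_scale c (star (p a))), star_continuous.
Qed.

(* With thresholds t_i = -B + i eps and u_i in M equal to 1 on {t_(i+1) <= f} and
   to 0 on {f <= t_i}, the function -B + eps (u_0 + ... + u_(n-1)) is within eps of f. *)
Lemma lincomb_dense {M : MVAlgebra} (f : MaxSpec M -> R) eps : hk_continuous f -> 0 < eps ->
  exists phi : list (R * M), forall x, Rabs (lincomb (hstar x) phi - f x) <= eps.
Proof.
  intros Hf He. destruct (hk_continuous_bounded f Hf) as [B HB].
  (* The first clause keeps the combination constant above the current threshold, so the next step
     adds its Urysohn element to an exact value. *)
  assert (E : forall n, exists phi : list (R * M), forall x,
    (- B + INR n * eps <= f x -> lincomb (hstar x) phi = - B + INR n * eps) /\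
    (f x <= - B + INR n * eps -> Rabs (lincomb (hstar x) phi - f x) <= eps)).
  { induction n as [|n [phi IH]].
    - exists ((- B, mv_one) :: nil). intro x. cbn.
      rewrite hom_one by apply hstar_hom. specialize (HB x). apply Rabs_le_bounds in HB.
      split; [lra|]. intro; apply Rabs_le_bounds; lra.
    - destruct (urysohn f (- B + INR n * eps) (- B + INR (S n) * eps)) as [u Hu];
        [exact Hf|rewrite S_INR; lra|].
      exists ((eps, u) :: phi). intro x. specialize (IH x); specialize (Hu x).
      destruct IH as [I1 I2], Hu as [U1 U2]. cbn [lincomb].
      pose proof (hom_bounds _ (hstar_hom x) u) as Bu. rewrite S_INR in *. split; intro L.
      + rewrite U2 by lra. rewrite I1 by lra. lra.
      + destruct (Rle_lt_dec (f x) (- B + INR n * eps)) as [L'|L'].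
        * rewrite U1 by lra. rewrite Rmult_0_r, Rplus_0_l. apply I2, L'.
        * rewrite I1 by lra. apply Rabs_le_bounds. nra. }
  (* For this [n], -B + n eps exceeds B, so every point falls under the second clause. *)
  destruct (INR_unbounded (2 * B / eps)) as [n Hn].
  destruct (E n) as [phi Hphi]. exists phi. intro x. apply Hphi.
  specialize (HB x). apply Rabs_le_bounds in HB.
  apply (Rmult_lt_compat_r eps) in Hn; [|exact He].
  replace (2 * B / eps * eps) with (2 * B) in Hn by (field; lra). lra.
Qed.

(** * States *)

(** In the last clause [mv_meet b (¬ a)] is the part of [b] that fits on top of [a] without
    overflow, which is why an untruncated real sum is right. *)
Definition is_state {M : MVAlgebra} (s : M -> R) : Prop :=
  (forall a, 0 <= s a) /\ s mv_one = 1 /\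
  (forall a b, s (a ⊕ b) = s a + s (mv_meet b (¬ a))).

(** Under [h] the sum in (P1) is not truncated: [mv_meet b (¬ a)] lies below [¬ a], so its image
    under [p] has value at most [1 - h (p a)]. *)
Lemma probability_state {M N : MVAlgebra} (p : M -> N) (h : N -> R) :
  probability_map p -> mv_hom_unit h -> is_state (fun a => h (p a)).
Proof.
  intros [P1 [P2 P3]] Hh. split; [|split].
  - intro a; apply (hom_bounds h Hh).
  - rewrite P3; apply (hom_one h Hh).
  - assert (Hmono : forall x y, mv_le x y -> h (p x) <= h (p y)).
    { intros x y L. rewrite (le_decomp x y L), P1. apply (hom_mono h Hh), le_oplus. }
    intros a b. rewrite P1, (hom_oplus h Hh), Rmin_right; [reflexivity|].
    assert (L : mv_le (mv_meet b (¬ a)) (¬ a)).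
    { rewrite <- (mv_negK _ (¬ a)) at 2. unfold mv_meet, mv_join. apply neg_mono.
      rewrite (mv_comm _ _ (¬ ¬ a)). apply le_oplus. }
    apply Hmono in L. rewrite P2, (hom_neg h Hh) in L. lra.
Qed.

Section State.
Context {M : MVAlgebra} (HM : semisimple M) (s : M -> R) (Hs : is_state s).
Implicit Types (a b : M) (l : list M) (phi psi : list (R * M)).

Local Ltac pointwise m :=
  apply (semisimple_eq _ _ HM); intro m;
  repeat (rewrite ?hom_oplus, ?hom_times, ?hom_meet, ?hom_neg, ?hom_zero by apply hstar_hom).

Lemma state_zero : s mv_zero = 0.
Proof.
  destruct Hs as [_ [_ Hadd]]. pose proof (Hadd mv_zero mv_zero) as E.
  rewrite oplus_0r in E.
  replace (mv_meet mv_zero (¬ mv_zero)) with (mv_zero : M) in E; [lra|].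
  pointwise m. rewrite Rmin_left; lra.
Qed.

Lemma state_mono a b : (forall m, hstar m a <= hstar m b) -> s a <= s b.
Proof.
  intro H. destruct Hs as [Hpos [_ Hadd]].
  rewrite (le_decomp a b) by (apply semisimple_le; assumption).
  rewrite Hadd. specialize (Hpos (mv_meet (b ⊙ ¬ a) (¬ a))). lra.
Qed.

Lemma state_le_one a : s a <= 1.
Proof.
  destruct Hs as [_ [H1 _]]. rewrite <- H1. apply state_mono; intro m.
  rewrite hom_one by apply hstar_hom. apply (hom_bounds _ (hstar_hom m)).
Qed.

(** [b] is the disjoint sum of [mv_meet b (¬ a)] and [b ⊙ a], so additivity applies a second
    time. *)
Lemma state_modular a b : s (a ⊕ b) + s (b ⊙ a) = s a + s b.
Proof.
  destruct Hs as [_ [_ Hadd]]. rewrite Hadd.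
  assert (E : s b = s (mv_meet b (¬ a)) + s (b ⊙ a)); [|lra].
  replace b with (mv_meet b (¬ a) ⊕ b ⊙ a) at 1.
  - rewrite Hadd. do 2 f_equal. pointwise m.
    pose proof (hom_bounds _ (hstar_hom m) a); pose proof (hom_bounds _ (hstar_hom m) b).
    unfold Rmin, Rmax; repeat destruct Rle_dec; lra.
  - pointwise m.
    pose proof (hom_bounds _ (hstar_hom m) a); pose proof (hom_bounds _ (hstar_hom m) b).
    unfold Rmin, Rmax; repeat destruct Rle_dec; lra.
Qed.

Lemma level_vanish l k : (length l <= k)%nat -> level l k = mv_zero.
Proof.
  intro H. apply (semisimple_eq _ _ HM); intro m.
  rewrite hstar_level, hom_zero by apply hstar_hom.
  assert (B : total (hstar m) l <= INR (length l)).
  { clear H; induction l as [|a l IH]; [cbn; lra|]. cbn [total length]. rewrite S_INR.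
    pose proof (hom_bounds _ (hstar_hom m) a); lra. }
  apply le_INR in H. unfold Rmin, Rmax; repeat destruct Rle_dec; lra.
Qed.

(* Where [level l (k+1)] is nonzero [level l k] is 1, so the modularity defects of
   adding [a] to the good sequence of [l] telescope. *)
Lemma state_level_cons a l k :
  sum_f_R0 (fun i => s (level (a :: l) i)) k =
  sum_f_R0 (fun i => s (level l i)) k + s a - s (a ⊙ level l k).
Proof.
  induction k as [|k IH].
  - cbn. pose proof (state_modular (level l 0) a); lra.
  - rewrite !tech5, IH. cbn [level].
    pose proof (state_modular (level l (S k)) (a ⊙ level l k)) as E.
    replace (a ⊙ level l k ⊙ level l (S k)) with (a ⊙ level l (S k)) in E; [lra|].
    pointwise m. rewrite !hstar_level, S_INR.
    pose proof (hom_bounds _ (hstar_hom m) a).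
    unfold Rmin, Rmax; repeat destruct Rle_dec; lra.
Qed.

(** From index [length l] on, levels vanish, so the remainder left by [state_level_cons]
    disappears. *)
Lemma state_level_sum l k : (length l <= k)%nat ->
  sum_f_R0 (fun i => s (level l i)) k = total s l.
Proof.
  revert k; induction l as [|a l IH]; intros k H.
  - cbn [total]. induction k as [|k IHk]; [apply state_zero|].
    rewrite tech5, IHk by (cbn; lia). cbn [level]. rewrite state_zero; lra.
  - cbn [length] in H. rewrite state_level_cons, IH, level_vanish, times_0r, state_zero by lia.
    cbn [total]; lra.
Qed.

(** Each level is a monotone function of the pointwise total, so the order passes to the good
    sequences term by term. *)
Lemma state_total_mono l l' :
  (forall m, total (hstar m) l <= total (hstar m) l') -> total s l <= total s l'.
Proof.
  intro H. set (k := (length l + length l')%nat).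
  rewrite <- (state_level_sum l k), <- (state_level_sum l' k) by lia.
  apply sum_Rle. intros i _. apply state_mono. intro m. rewrite !hstar_level.
  specialize (H m). unfold Rmin, Rmax; repeat destruct Rle_dec; lra.
Qed.

(* Rounding up the coefficients of [n * phi] to integers. *)
Lemma lincomb_round (n : nat) (phi : list (R * M)) :
  exists l l' : list M, forall w, (forall a, 0 <= w a <= 1) ->
    INR n * lincomb w phi <= total w l - total w l' <=
    INR n * lincomb w phi + INR (length phi).
Proof.
  induction phi as [|[c a] phi [l [l' IH]]].
  - exists nil, nil; intros; cbn; lra.
  - set (q := up (INR n * c)).
    (* The two lists receive the positive and the negative part of [q]. Since [up] overshoots by at
       most 1 and [w] is at most 1, each term adds an error of at most 1. *)
    exists (repeat a (Z.to_nat q) ++ l), (repeat a (Z.to_nat (- q)) ++ l').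
    intros w Hw. specialize (IH w Hw).
    rewrite !total_app, !total_repeat. cbn [lincomb length]. rewrite S_INR.
    assert (E : INR (Z.to_nat q) - INR (Z.to_nat (- q)) = IZR q).
    { rewrite !INR_IZR_INZ, <- minus_IZR; f_equal; lia. }
    destruct (archimed (INR n * c)) as [A1 A2]. fold q in A1, A2. specialize (Hw a).
    replace (INR (Z.to_nat q) * w a + total w l - (INR (Z.to_nat (- q)) * w a + total w l'))
      with (IZR q * w a + (total w l - total w l')) by (rewrite <- E; ring).
    nra.
Qed.

(** The rounding error [length phi] does not depend on the multiplier, so a negative value would
    survive multiplication by a large integer and contradict [state_total_mono]. *)
Lemma state_lincomb_pos phi : (forall m, 0 <= lincomb (hstar m) phi) -> 0 <= lincomb s phi.
Proof.
  intro H. destruct (Rle_lt_dec 0 (lincomb s phi)) as [L|L]; [exact L|exfalso].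
  destruct (INR_unbounded (INR (length phi) / - lincomb s phi)) as [n Hn].
  destruct (lincomb_round n phi) as [l [l' Hl]].
  assert (T : total s l' <= total s l).
  { apply state_total_mono; intro m.
    destruct (Hl (hstar m) (hom_bounds _ (hstar_hom m))) as [B _].
    pose proof (pos_INR n). specialize (H m). nra. }
  destruct (Hl s) as [_ B]; [intro a; split; [apply Hs|apply state_le_one]|].
  apply (Rmult_lt_compat_r (- lincomb s phi)) in Hn; [|lra].
  unfold Rdiv in Hn. rewrite Rmult_assoc, Rinv_l in Hn by lra. lra.
Qed.

(** * Extension of a state to continuous functions *)

Definition approx (f : MaxSpec M -> R) (eps : R) (phi : list (R * M)) : Prop :=
  forall x, Rabs (lincomb (hstar x) phi - f x) <= eps.

(** The combination psi - phi + eps + del is pointwise nonnegative, so [state_lincomb_pos]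
    applies. *)
Lemma state_approx_compare f phi psi eps del :
  approx f eps phi -> approx f del psi -> lincomb s phi - eps <= lincomb s psi + del.
Proof.
  intros H H'.
  pose proof (state_lincomb_pos (psi ++ lc_scale (-1) phi ++ (eps + del, mv_one) :: nil)) as P.
  rewrite !lincomb_app, lincomb_scale in P. cbn [lincomb] in P.
  destruct Hs as [_ [H1 _]]. rewrite H1 in P.
  enough (0 <= lincomb s psi + (-1 * lincomb s phi + ((eps + del) * 1 + 0))) by lra.
  apply P. intro m. rewrite !lincomb_app, lincomb_scale. cbn [lincomb].
  rewrite hom_one by apply hstar_hom. specialize (H m); specialize (H' m).
  apply Rabs_le_bounds in H, H'. lra.
Qed.

(** The intervals of radius [eps] around the values [lincomb s phi] meet pairwise by
    [state_approx_compare], and the supremum of their left ends lies in all of them. *)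
Lemma state_extension_ex f : hk_continuous f ->
  exists r, forall eps phi, approx f eps phi -> Rabs (lincomb s phi - r) <= eps.
Proof.
  intro Hf. destruct (lincomb_dense f 1 Hf Rlt_0_1) as [phi0 H0].
  destruct (completeness (fun r => exists eps phi, approx f eps phi /\ r = lincomb s phi - eps))
    as [r [Hub Hlub]].
  - exists (lincomb s phi0 + 1). intros r [eps [phi [H ->]]].
    apply (state_approx_compare f); assumption.
  - exists (lincomb s phi0 - 1), 1, phi0; auto.
  - exists r. intros eps phi H. apply Rabs_le_bounds.
    assert (lincomb s phi - eps <= r) by (apply Hub; exists eps, phi; auto).
    assert (r <= lincomb s phi + eps); [|lra].
    apply Hlub. intros r' [del [psi [H' ->]]]. apply (state_approx_compare f); assumption.
Qed.

Definition state_extension (f : MaxSpec M -> R) : R :=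
  epsilon (inhabits 0)
    (fun r => forall eps phi, approx f eps phi -> Rabs (lincomb s phi - r) <= eps).

Lemma state_extension_spec f eps phi : hk_continuous f -> approx f eps phi ->
  Rabs (lincomb s phi - state_extension f) <= eps.
Proof.
  intros Hf. revert eps phi. apply (epsilon_spec (inhabits 0) _ (state_extension_ex f Hf)).
Qed.

Lemma Rabs_small_eq x y C : (forall eps, 0 < eps -> Rabs (x - y) <= C * eps) -> x = y.
Proof.
  intro H. destruct (Req_dec x y) as [E|E]; [exact E|exfalso].
  assert (P : 0 < Rabs (x - y)) by (apply Rabs_pos_lt; lra).
  destruct (Rle_lt_dec C 0) as [L|L].
  - specialize (H 1 Rlt_0_1). lra.
  - specialize (H (Rabs (x - y) / (2 * C))).
    replace (C * (Rabs (x - y) / (2 * C))) with (Rabs (x - y) / 2) in H by (field; lra).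
    enough (Rabs (x - y) <= Rabs (x - y) / 2) by lra.
    apply H, Rdiv_lt_0_compat; lra.
Qed.

Lemma state_extension_exact f phi : hk_continuous f ->
  (forall x, lincomb (hstar x) phi = f x) -> state_extension f = lincomb s phi.
Proof.
  intros Hf H. pose proof (state_extension_spec f 0 phi Hf) as E.
  assert (A : approx f 0 phi) by (intro x; rewrite H, Rminus_diag, Rabs_R0; lra).
  apply E, Rabs_le_bounds in A. lra.
Qed.

Lemma state_extension_plus f g : hk_continuous f -> hk_continuous g ->
  state_extension (fun x => f x + g x) = state_extension f + state_extension g.
Proof.
  intros Hf Hg. apply (Rabs_small_eq _ _ 4). intros eps He.
  destruct (lincomb_dense f eps Hf He) as [phi Hphi].
  destruct (lincomb_dense g eps Hg He) as [psi Hpsi].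
  pose proof (state_extension_spec f eps phi Hf Hphi) as E1.
  pose proof (state_extension_spec g eps psi Hg Hpsi) as E2.
  pose proof (state_extension_spec (fun x => f x + g x) (2 * eps) (phi ++ psi)
    (hk_continuous_plus f g Hf Hg)) as E3.
  rewrite lincomb_app in E3.
  assert (A : approx (fun x => f x + g x) (2 * eps) (phi ++ psi)).
  { intro x. rewrite lincomb_app. specialize (Hphi x); specialize (Hpsi x).
    apply Rabs_le_bounds in Hphi, Hpsi. apply Rabs_le_bounds; lra. }
  specialize (E3 A). apply Rabs_le_bounds in E1, E2, E3. apply Rabs_le_bounds; lra.
Qed.

Lemma state_extension_scale c f : hk_continuous f ->
  state_extension (fun x => c * f x) = c * state_extension f.
Proof.
  intros Hf. apply (Rabs_small_eq _ _ (2 * Rabs c)). intros eps He.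
  destruct (lincomb_dense f eps Hf He) as [phi Hphi].
  pose proof (state_extension_spec f eps phi Hf Hphi) as E1.
  pose proof (state_extension_spec (fun x => c * f x) (Rabs c * eps) (lc_scale c phi)
    (hk_continuous_scale c f Hf)) as E2.
  rewrite lincomb_scale in E2.
  assert (A : approx (fun x => c * f x) (Rabs c * eps) (lc_scale c phi)).
  { intro x. rewrite lincomb_scale, <- Rmult_minus_distr_l, Rabs_mult.
    apply Rmult_le_compat_l; [apply Rabs_pos|apply Hphi]. }
  specialize (E2 A).
  apply (Rmult_le_compat_l (Rabs c)) in E1; [|apply Rabs_pos].
  rewrite <- Rabs_mult, Rmult_minus_distr_l in E1.
  apply Rabs_le_bounds in E1, E2. apply Rabs_le_bounds; lra.
Qed.

Lemma state_extension_pos f : hk_continuous f -> (forall x, 0 <= f x) -> 0 <= state_extension f.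
Proof.
  intros Hf Hpos. apply le_epsilon. intros eps He.
  destruct (lincomb_dense f (eps / 2) Hf) as [phi Hphi]; [lra|].
  pose proof (state_extension_spec f (eps / 2) phi Hf Hphi) as E.
  pose proof (state_lincomb_pos ((eps / 2, mv_one) :: phi)) as P. cbn [lincomb] in P.
  destruct Hs as [_ [H1 _]]. rewrite H1 in P.
  enough (0 <= eps / 2 * 1 + lincomb s phi) by (apply Rabs_le_bounds in E; lra).
  apply P. intro m. rewrite hom_one by apply hstar_hom.
  specialize (Hphi m); specialize (Hpos m). apply Rabs_le_bounds in Hphi; lra.
Qed.

End State.

(** * Unital positive operators and uniqueness *)

Lemma upl_mono {M N : MVAlgebra} (L : (MaxSpec M -> R) -> MaxSpec N -> R) f g y :
  unital_positive_linear L -> hk_continuous f -> hk_continuous g ->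
  (forall x, f x <= g x) -> L f y <= L g y.
Proof.
  intros [_ [Ladd [Lscale [Lpos _]]]] Hf Hg Hfg.
  pose proof (hk_continuous_scale (-1) f Hf) as Hf'.
  pose proof (Lpos _ (hk_continuous_plus _ _ Hg Hf')) as P.
  specialize (P ltac:(intro x; specialize (Hfg x); lra) y).
  rewrite Ladd, Lscale in P by assumption. lra.
Qed.

Lemma upl_const {M N : MVAlgebra} (L : (MaxSpec M -> R) -> MaxSpec N -> R) c y :
  unital_positive_linear L -> L (fun _ => c) y = c.
Proof.
  intros [_ [_ [Lscale [_ L1]]]].
  pose proof (Lscale c (fun _ => 1) (hk_continuous_const 1) y) as E.
  rewrite L1, Rmult_1_r in E. exact E.
Qed.

Lemma upl_lincomb {M N : MVAlgebra} (L : (MaxSpec M -> R) -> MaxSpec N -> R) phi y :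
  unital_positive_linear L ->
  L (fun x => lincomb (hstar x) phi) y = lincomb (fun a => L (star a) y) phi.
Proof.
  intro HL. induction phi as [|[c a] phi IH]; [apply (upl_const L 0 y HL)|].
  destruct HL as [_ [Ladd [Lscale _]]]. cbn [lincomb]. rewrite <- IH.
  rewrite <- Lscale by apply star_continuous.
  apply (Ladd (fun x => c * star a x) (fun x => lincomb (hstar x) phi)).
  - apply hk_continuous_scale, star_continuous.
  - apply (lincomb_continuous (fun a => a)).
Qed.

(** Positivity and unitality preserve the sandwich f - eps <= phi <= f + eps, so [L] is determined
    by its values on the transforms. *)
Lemma upl_approx {M N : MVAlgebra} (L : (MaxSpec M -> R) -> MaxSpec N -> R) f eps phi y :
  unital_positive_linear L -> hk_continuous f -> approx f eps phi ->
  Rabs (lincomb (fun a => L (star a) y) phi - L f y) <= eps.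
Proof.
  intros HL Hf A. rewrite <- upl_lincomb by exact HL.
  pose proof (lincomb_continuous (fun a : M => a) phi) as Hphi. cbv beta in Hphi.
  assert (B : forall d, L (fun x => f x + d) y = L f y + d).
  { intro d. transitivity (L f y + L (fun _ => d) y).
    - apply HL; [exact Hf|apply hk_continuous_const].
    - rewrite upl_const by exact HL; reflexivity. }
  assert (L1 : L (fun x => lincomb (hstar x) phi) y <= L (fun x => f x + eps) y).
  { apply upl_mono; auto using hk_continuous_plus, hk_continuous_const.
    intro x; specialize (A x); apply Rabs_le_bounds in A; lra. }
  assert (L2 : L (fun x => f x + - eps) y <= L (fun x => lincomb (hstar x) phi) y).
  { apply upl_mono; auto using hk_continuous_plus, hk_continuous_const.
    intro x; specialize (A x); apply Rabs_le_bounds in A; lra. }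
  rewrite B in L1, L2. apply Rabs_le_bounds; lra.
Qed.

Theorem theorem3p9 (M N : MVAlgebra) (p : M -> N) :
  semisimple M -> semisimple N -> probability_map p ->
  exists L : (MaxSpec M -> R) -> (MaxSpec N -> R),
    (unital_positive_linear L /\ forall (a : M) (n : MaxSpec N), star (p a) n = L (star a) n) /\
    forall L' : (MaxSpec M -> R) -> (MaxSpec N -> R),
      unital_positive_linear L' ->
      (forall (a : M) (n : MaxSpec N), star (p a) n = L' (star a) n) ->
      forall f : MaxSpec M -> R, hk_continuous f -> forall n, L' f n = L f n.
Proof.
  intros HM _ Hp.
  set (s := fun (n : MaxSpec N) a => hstar n (p a)).
  assert (Hs : forall n, is_state (s n)) 
    by (intro n; exact (probability_state p (hstar n) Hp (hstar_hom n))).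
  exists (fun f n => state_extension (s n) f). split; [split|].
  - split; [|split; [|split; [|split]]].
    + intros f Hf. apply hk_continuous_uniform_limit. intros eps He.
      destruct (lincomb_dense f eps Hf He) as [phi Hphi].
      (* The same [phi] serves every [n], so the approximation by transforms of the [p a] is uniform
         on [MaxSpec N]. *)
      exists (fun n => lincomb (s n) phi). split; [apply lincomb_continuous|].
      intro n. apply state_extension_spec; auto.
    + intros f g Hf Hg n. apply state_extension_plus; auto.
    + intros c f Hf n. apply state_extension_scale; auto.
    + intros f Hf Hpos n. apply state_extension_pos; auto.
    + intro n. rewrite (state_extension_exact HM (s n) (Hs n) _ ((1, mv_one) :: nil)).
      * cbn. destruct (Hs n) as [_ [H1 _]]. rewrite H1; lra.
      * apply hk_continuous_const.
      * intro x; cbn. rewrite hom_one by apply hstar_hom; lra.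
  - intros a n. rewrite (state_extension_exact HM (s n) (Hs n) _ ((1, a) :: nil)).
    + unfold star, s; cbn; lra.
    + apply star_continuous.
    + intro x; unfold star; cbn; lra.
  - intros L' HL' Hstar f Hf n. apply (Rabs_small_eq _ _ 2). intros eps He.
    destruct (lincomb_dense f eps Hf He) as [phi Hphi].
    pose proof (upl_approx L' f eps phi n HL' Hf Hphi) as E1.
    pose proof (state_extension_spec HM (s n) (Hs n) f eps phi Hf Hphi) as E2.
    (* The hypothesis on [L'] makes it agree with the state on transforms, so both values lie within
       [eps] of the same number. *)
    replace (fun a => L' (star a) n) with (s n) in E1
      by (apply functional_extensionality; intro a; apply Hstar).
    apply Rabs_le_bounds in E1, E2. apply Rabs_le_bounds; lra.
Qed.
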